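(* For every integer $m\ge 3$, the graph colouring game on the Hadamard graph $G_{4m}$ with $c=4m$ colours is a pseudo-telepathy game.
   Context: Hadamard graph: for $N=4k$, $k$ a positive integer, $G_N$ has vertex set $V_N=\{0,1\}^N$ and edge set $E_N=\{(u,v)\in V_N^2 : d_H(u,v)=N/2\}$, where $d_H$ is Hamming distance. Graph colouring game on a finite graph $G=(V,E)$ with $c$ colours: a verifier sends $a\in V$ to Alice and $b\in V$ to Bob, where $a=b$ or $(a,b)\in E$. Alice and Bob, who may not communicate after receiving $a$ and $b$, answer with colours $c_A$ and $c_B$ respectively, out of $c$ possible colours. They win if ($a\ne b$ and $c_A\neq c_B$) or ($a=b$ and $c_A=c_B$), and lose otherwise. A protocol is successful with probability $1$ if for every allowed pair $(a,b)$ it wins with probability $1$. Protocols without shared entanglement (classical): before receiving the questions, Alice and Bob may communicate and share classical information (including shared randomness); each then answers as a function of their own question and this information. Protocols with shared entanglement: before receiving the questions, Alice and Bob share a bipartite quantum state on a tensor product of two finite-dimensional Hilbert spaces; after receiving the questions, each performs a local measurement, depending on their own question, on their own factor, and outputs a colour determined by the outcome. The graph colouring game on $G$ with $c$ colours is a pseudo-telepathy game if there is a protocol with shared entanglement that is successful with probability $1$, but there is no protocol without shared entanglement that is successful with probability $1$. *)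

(* Defs.v *)
From HB Require Import structures.
From mathcomp Require Import all_boot all_order all_algebra.
From mathcomp Require Import sesquilinear spectral.
From mathcomp Require Import complex mxtens.
From mathcomp Require Import all_classical all_reals all_analysis.

Set Implicit Arguments.
Unset Strict Implicit.
Unset Printing Implicit Defensive.

Import Order.TTheory GRing.Theory Num.Theory.
Local Open Scope ring_scope.
Local Open Scope complex_scope.
Local Open Scope sesquilinear_scope.

(* A finite graph is given by a vertex finType and an edge relation. *)

Definition hamming (N : nat) (u v : {ffun 'I_N -> bool}) : nat :=
  #|[set i | u i != v i]%SET|.

(* The Hadamard graph G_N is considered only for N a positive multiple of 4,
   where the division is exact. *)
Definition hadamard_graph (N : nat) : rel {ffun 'I_N -> bool} :=
  fun u v => hamming u v == (N %/ 2)%N.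
Arguments hadamard_graph N u v : clear implicits.

Definition allowed (V : finType) (e : rel V) (a b : V) : bool :=
  (a == b) || e a b.

Definition winning (V : finType) (c : nat) (a b : V) (cA cB : 'I_c) : bool :=
  ((a != b) && (cA != cB)) || ((a == b) && (cA == cB)).

(* Everything the players share before the questions is a point of an arbitrary
   probability space; the measurability fields give the winning events a
   probability. *)
Record classical_protocol (R : realType) (V : finType) (c : nat) := Classical {
  info_display : measure_display;
  info : measurableType info_display;
  info_law : probability info R;
  calice : V -> info -> 'I_c;
  cbob : V -> info -> 'I_c;
  calice_measurable : forall a k, measurable [set w | calice a w = k]%classic;
  cbob_measurable : forall b k, measurable [set w | cbob b w = k]%classic }.

Arguments calice {R V c} p a w : rename.
Arguments cbob {R V c} p b w : rename.

Definition classical_win_prob (R : realType) (V : finType) (c : nat)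
    (p : classical_protocol R V c) (a b : V) : \bar R :=
  info_law p [set w | winning a b (calice p a w) (cbob p b w)]%classic.

Definition classical_successful (R : realType) (V : finType) (e : rel V)
    (c : nat) (p : classical_protocol R V c) : Prop :=
  forall a b, allowed e a b -> classical_win_prob p a b = 1%E.

(* In R[i], 0 <= z means that z is real and nonnegative, so this condition
   forces A to be Hermitian. *)
Definition psdmx (R : realType) (n : nat) (A : 'M[R[i]]_n) : Prop :=
  forall v : 'cV[R[i]]_n, 0 <= (v ^t* *m A *m v) 0 0.

(* Density operators; the trace condition excludes n = 0. *)
Record quantum_state (R : realType) (n : nat) := QState {
  density : 'M[R[i]]_n;
  density_psd : psdmx density;
  density_tr : \tr density = 1 }.

(* General (POVM) measurements with an arbitrary finite set of outcomes. *)
Record measurement (R : realType) (n : nat) := Measurement {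
  outcome : finType;
  effect : outcome -> 'M[R[i]]_n;
  effect_psd : forall x, psdmx (effect x);
  effect_sum : \sum_x effect x = 1%:M }.

(* C^dimA (x) C^dimB is identified with C^(dimA * dimB) through [mxtens_index],
   which makes the Kronecker product [*t] the tensor product of operators. *)
Record quantum_protocol (R : realType) (V : finType) (c : nat) := Quantum {
  dimA : nat;
  dimB : nat;
  shared_state : quantum_state R (dimA * dimB);
  measA : V -> measurement R dimA;
  measB : V -> measurement R dimB;
  colourA : forall a, outcome (measA a) -> 'I_c;
  colourB : forall b, outcome (measB b) -> 'I_c }.

Arguments dimA {R V c} p : rename.
Arguments dimB {R V c} p : rename.
Arguments measA {R V c} p a : rename.
Arguments measB {R V c} p b : rename.
Arguments colourA {R V c} p a x : rename.
Arguments colourB {R V c} p b y : rename.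

(* Born rule, summed over the winning pairs of outcomes. *)
Definition quantum_win_prob (R : realType) (V : finType) (c : nat)
    (p : quantum_protocol R V c) (a b : V) : R[i] :=
  \sum_(x : outcome (measA p a))
    \sum_(y : outcome (measB p b) | winning a b (colourA p a x) (colourB p b y))
      \tr ((effect x *t effect y) *m density (shared_state p)).

Definition quantum_successful (R : realType) (V : finType) (e : rel V)
    (c : nat) (p : quantum_protocol R V c) : Prop :=
  forall a b, allowed e a b -> quantum_win_prob p a b = 1.

Definition pseudo_telepathy (R : realType) (V : finType) (e : rel V)
    (c : nat) : Prop :=
  (exists p : quantum_protocol R V c, quantum_successful e p) /\
  ~ (exists p : classical_protocol R V c, classical_successful e p).

(* Main.v *)
Require Import Defs.
From mathcomp Require Import all_boot all_order all_algebra.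
From mathcomp Require Import spectral complex mxtens.
From mathcomp Require Import all_classical all_reals all_analysis.
From mathcomp Require Import ring lra zify.
From mathcomp Require cyclic separable cyclotomic.

(* Let N = 4m and n = N/2.

   A perfect classical protocol is almost surely a proper colouring of G_N with
   N colours.  Expand the indicators f of its colour classes in the Walsh
   characters.  The adjacency eigenvalue of a character depends only on its
   weight j; the least one is -D/(N-1), where D is the degree, and it occurs
   exactly for j = 2 and j = N-2.  Summing the Hoffman bound over the N classes
   and comparing with Cauchy-Schwarz leaves no slack: a nonempty class has
   density 1/N and Fourier support in weights 0, 2, N-2.

   Let x be a vertex of such a class.  Pair coordinate i with i + n, and let U
   be the group of vectors constant on pairs, h the indicator of the first half.
   On x + U the function f is a polynomial of degree at most 2 which is nonzero
   at x, so it has density at least 1/4 there.  A character of weight 2 or N-2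
   that is trivial on U takes the value -1 at h, so the densities of f on x + U
   and on x + h + U add up to 2/N.  Hence 2/N >= 1/4, that is, N <= 8.

   For the quantum protocol, the players share a maximally entangled state of
   two N-level systems; on input a, Alice applies the signs (-1)^(a_i) and
   measures in the Fourier basis, and Bob does the same with complex
   conjugates.  The amplitude of the answers (k, l) on (a, b) is proportional
   to the sum over i of (-1)^(a_i + b_i) z^(i (k - l)), which vanishes whenever
   the players would lose. *)

Set Implicit Arguments.
Unset Strict Implicit.
Unset Printing Implicit Defensive.

Import Order.TTheory GRing.Theory Num.Theory.
Local Open Scope ring_scope.
Local Open Scope sesquilinear_scope.

(** * Walsh characters *)

Definition cube (N : nat) := {ffun 'I_N -> bool}.

Definition xorf N (x y : cube N) : cube N := [ffun i => x i (+) y i].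

Definition zerof N : cube N := [ffun=> false].

Definition weight N (x : cube N) : nat := \sum_i x i.

Definition walsh N (s x : cube N) : rat := \prod_i (-1) ^+ (s i && x i).

Definition fourier N (f : cube N -> rat) (s : cube N) : rat :=
  \sum_x f x * walsh s x.

Lemma xorfA N : associative (@xorf N).
Proof. by move=> x y z; apply/ffunP => i; rewrite !ffunE addbA. Qed.

Lemma xorfC N : commutative (@xorf N).
Proof. by move=> x y; apply/ffunP => i; rewrite !ffunE addbC. Qed.

Lemma xorff N (x : cube N) : xorf x x = zerof N.
Proof. by apply/ffunP => i; rewrite !ffunE addbb. Qed.

Lemma xorf0 N (x : cube N) : xorf x (zerof N) = x.
Proof. by apply/ffunP => i; rewrite !ffunE addbF. Qed.

Lemma xorf_eq0 N (x y : cube N) : (xorf x y == zerof N) = (x == y).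
Proof.
apply/eqP/eqP => [xy0|->]; last exact: xorff.
by rewrite -(xorf0 x) -(xorff y) xorfA xy0 xorfC xorf0.
Qed.

Lemma hamming_xorf N (x y : cube N) : hamming x y = weight (xorf x y).
Proof.
rewrite /hamming /weight -sum1_card big_mkcond /=.
by apply: eq_bigr => i _; rewrite inE ffunE; case: (x i); case: (y i).
Qed.

Lemma weight_le N (x : cube N) : (weight x <= N)%N.
Proof.
rewrite -[leqRHS]card_ord -sum1_card leq_sum // => i _.
exact: leq_b1.
Qed.

Lemma weight_eq0 N (x : cube N) : (weight x == 0)%N = (x == zerof N).
Proof.
rewrite /weight sum_nat_eq0; apply/forallP/eqP => [x0|->] /=.
  by apply/ffunP => i; have := x0 i; rewrite ffunE; case: (x i).
by move=> i; rewrite ffunE.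
Qed.

Lemma walshC N (s x : cube N) : walsh s x = walsh x s.
Proof. by apply: eq_bigr => i _; rewrite andbC. Qed.

Lemma walsh_xorr N (s x y : cube N) :
  walsh s (xorf x y) = walsh s x * walsh s y.
Proof.
rewrite -big_split; apply: eq_bigr => i _; rewrite ffunE.
by case: (s i) (x i) (y i) => [] [] [] //=;
   rewrite !(expr1, mulrNN, mulr1, mul1r).
Qed.

Lemma walsh_xorl N (s t x : cube N) :
  walsh (xorf s t) x = walsh s x * walsh t x.
Proof. by rewrite walshC walsh_xorr !(walshC x). Qed.

Lemma walsh0r N (s : cube N) : walsh s (zerof N) = 1.
Proof. by rewrite /walsh big1 // => i _; rewrite ffunE andbF. Qed.

Lemma walsh_sum N (s : cube N) :
  \sum_x walsh s x = (2 ^ N)%:R *+ (s == zerof N).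
Proof.
rewrite /walsh -(bigA_distr_bigA (fun i b => (-1) ^+ (s i && b))) /=.
have [->|/eqP s0] := eqVneq.
  rewrite (eq_bigr (fun=> 2)) => [|i _]; last by rewrite big_bool ffunE.
  by rewrite prodr_const card_ord natrX.
have [i si] : exists i, s i.
  apply/existsP; apply: contra_notT s0 => /existsPn s0.
  by apply/ffunP => i; rewrite ffunE; apply/negbTE/s0.
by rewrite (bigD1 i) //= big_bool si /= expr1 addNr mul0r.
Qed.

(** Expanding the square and summing over [s] leaves only [w = xorf x y], by orthogonality of
    characters. A point mass [d] at zero gives Parseval; the indicator of a sphere diagonalises the
    adjacency form. *)
Lemma walsh_parseval N (d f : cube N -> rat) :
  \sum_s (\sum_w d w * walsh s w) * fourier f s ^+ 2 =
  (2 ^ N)%:R * \sum_x \sum_y f x * f y * d (xorf x y).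
Proof.
transitivity (\sum_w \sum_x \sum_y d w * f x * f y *
    \sum_s walsh (xorf w (xorf x y)) s).
  rewrite (eq_bigr (fun s => \sum_w \sum_x \sum_y d w * f x * f y *
     walsh (xorf w (xorf x y)) s)) => [|s _].
    rewrite exchange_big; apply: eq_bigr => w _.
    rewrite exchange_big; apply: eq_bigr => x _.
    rewrite exchange_big; apply: eq_bigr => y _.
    by rewrite mulr_sumr.
  rewrite mulr_suml; apply: eq_bigr => w _.
  rewrite expr2 mulr_suml mulr_sumr; apply: eq_bigr => x _.
  rewrite 2!mulr_sumr; apply: eq_bigr => y _.
  rewrite 2!walsh_xorl !(walshC s); ring.
rewrite exchange_big mulr_sumr; apply: eq_bigr => x _.
rewrite exchange_big mulr_sumr; apply: eq_bigr => y _.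
rewrite (bigD1 (xorf x y)) //= walsh_sum xorff eqxx mulr1n big1 => [|w wxy].
  ring.
by rewrite walsh_sum xorf_eq0 (negbTE wxy) mulr0.
Qed.

Lemma fourier_inversion N (f : cube N -> rat) x :
  \sum_s fourier f s * walsh s x = (2 ^ N)%:R * f x.
Proof.
transitivity (\sum_y f y * \sum_s walsh (xorf y x) s).
  rewrite (eq_bigr (fun s => \sum_y f y * walsh (xorf y x) s)) => [|s _].
    by rewrite exchange_big; apply: eq_bigr => y _; rewrite mulr_sumr.
  rewrite mulr_suml; apply: eq_bigr => y _.
  by rewrite walsh_xorl !(walshC s) mulrA.
rewrite (bigD1 x) //= walsh_sum xorff eqxx mulr1n big1 => [|y yx].
  by rewrite addr0 mulrC.
by rewrite walsh_sum xorf_eq0 (negbTE yx) mulr0.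
Qed.

Lemma weight_compl N (s : cube N) : (\sum_i ~~ s i)%N = (N - weight s)%N.
Proof.
apply/eqP; rewrite -(eqn_add2r (weight s)) subnK ?weight_le // -big_split /=.
rewrite (eq_bigr (fun=> 1%N)) ?sum1_card ?card_ord // => i _.
by case: (s i).
Qed.

(** The value at [j] of the Krawtchouk polynomial of degree [n], read off its generating
    function. *)
Definition krawtchouk (N n j : nat) : rat :=
  ((1 - 'X) ^+ j * (1 + 'X) ^+ (N - j) : {poly rat})`_n.

Definition sphere_sum N n (s : cube N) : rat :=
  \sum_(w | weight w == n) walsh s w.

(** With ['X] marking the weight of [w], the sum over the cube factors over coordinates: each
    contributes [1 - 'X] or [1 + 'X] according to [s i]. *)
Lemma sphere_sumE N n (s : cube N) :
  sphere_sum n s = krawtchouk N n (weight s).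
Proof.
transitivity
  (\prod_i (\sum_(b : bool) ((-1) ^+ (s i && b))%:P * 'X^b) : {poly rat})`_n.
  rewrite bigA_distr_bigA coef_sum /sphere_sum big_mkcond.
  apply: eq_bigr => w _.
  rewrite big_split /= -rmorph_prod -[X in _ * X]expr_sum coefCM coefXn.
  rewrite eq_sym -/(weight w).
  by rewrite -/(walsh s w) -mulr_natr; case: eqP; rewrite (mulr1, mulr0).
rewrite /krawtchouk; congr (_`_n).
rewrite (eq_bigr (fun i => (1 - 'X) ^+ s i * (1 + 'X) ^+ ~~ s i)) => [|i _].
  rewrite big_split /= -!expr_sum -/(weight s).
  by rewrite weight_compl.
rewrite big_bool andbT andbF expr0 mulr1 [LHS]addrC.
by case: (s i); rewrite /= ?expr1 ?expr0 ?polyCN ?polyC1 ?mulr1 ?mul1r ?mulN1r.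
Qed.

(** * Eigenvalues of the Hadamard graph *)

Definition prefix_vec N (j : nat) : cube N := [ffun i : 'I_N => (i < j)%N].

Definition unit_vec N (i : 'I_N) : cube N := [ffun k => k == i].

Definition onef N : cube N := [ffun=> true].

Lemma weight_prefix_vec N j : (j <= N)%N -> weight (prefix_vec N j) = j.
Proof.
move=> jN; rewrite /weight -[RHS]card_ord -sum1_card.
rewrite (big_ord_widen N (fun=> 1%N) jN).
rewrite [RHS]big_mkcond; apply: eq_bigr => i _.
by rewrite ffunE; case: ifP.
Qed.

Lemma walsh_unit_vec N (i : 'I_N) w : walsh (unit_vec i) w = (-1) ^+ w i.
Proof.
rewrite /walsh (bigD1 i) //= ffunE eqxx big1 ?mulr1 // => k ki.
by rewrite ffunE (negbTE ki).
Qed.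

Lemma walsh_onef N (w : cube N) : walsh (onef N) w = (-1) ^+ weight w.
Proof. by rewrite /weight expr_sum; apply: eq_bigr => i _; rewrite ffunE. Qed.

Lemma weight_xor_unit N (s : cube N) i :
  weight (xorf s (unit_vec i)) = if s i then (weight s).-1 else (weight s).+1.
Proof.
have rest : (\sum_(k | k != i) xorf s (unit_vec i) k = \sum_(k | k != i) s k)%N.
  by apply: eq_bigr => k /negbTE ki; rewrite !ffunE ki addbF.
rewrite /weight (bigD1 i) //= [in RHS](bigD1 i) //= rest !ffunE eqxx.
by case: (s i).
Qed.

Lemma weight_xor_onef N (s : cube N) :
  weight (xorf s (onef N)) = (N - weight s)%N.
Proof.
by rewrite -weight_compl; apply: eq_bigr => i _; rewrite !ffunE addbT.
Qed.

Lemma sum_sign (F : pzRingType) N (w : cube N) :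
  \sum_i (-1) ^+ w i = N%:R - (weight w)%:R *+ 2 :> F.
Proof.
rewrite (eq_bigr (fun i => 1 - (w i)%:R *+ 2)) => [|i _]; last first.
  by case: (w i); rewrite ?mul0rn ?subr0 // mulr2n opprD addrA subrr sub0r.
by rewrite sumrB sumr_const card_ord sumrMnl -natr_sum.
Qed.

(* Otherwise unification computes polynomial coefficients. *)
Opaque krawtchouk.

(** On the sphere of weight [n] the signs [(-1) ^+ w i] sum to zero over [i]. Flipping one
    coordinate of a vector of weight [j] gives weight [j - 1] in [j] cases and [j + 1] in the
    others. At both ends the out-of-range index has coefficient zero. *)
Lemma krawtchouk_rec n j : (j <= n + n)%N ->
  j%:R * krawtchouk (n + n) n j.-1 +
  (n + n - j)%:R * krawtchouk (n + n) n j.+1 = 0.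
Proof.
move=> jN; pose s := prefix_vec (n + n) j.
have ws : weight s = j := weight_prefix_vec jN.
have sum0 : \sum_i sphere_sum n (xorf s (unit_vec i)) = 0.
  rewrite /sphere_sum exchange_big big1 //= => w /eqP wn.
  rewrite (eq_bigr (fun i => walsh s w * (-1) ^+ w i)) => [|i _].
    by rewrite -mulr_sumr sum_sign wn mulr2n -natrD subrr mulr0.
  by rewrite walsh_xorl walsh_unit_vec.
rewrite -[RHS]sum0 -[in X in X * _ + _]ws -[in X in _ + X * _]ws -weight_compl.
rewrite /weight !natr_sum !mulr_suml -big_split; apply: eq_bigr => i _.
rewrite sphere_sumE weight_xor_unit ws.
by case: (s i); rewrite /= !(mul1r, mul0r, addr0, add0r).
Qed.

(** The all-ones character is constantly [1] on the sphere of even weight [n]. *)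
Lemma krawtchouk_sym n j : ~~ odd n -> (j <= n + n)%N ->
  krawtchouk (n + n) n (n + n - j) = krawtchouk (n + n) n j.
Proof.
move=> evn jN; rewrite -(weight_prefix_vec jN) -weight_xor_onef -!sphere_sumE.
apply: eq_bigr => w /eqP wn.
by rewrite walsh_xorl walsh_onef wn -signr_odd (negbTE evn) mulr1.
Qed.

Lemma krawtchouk0_gt0 n : 0 < krawtchouk (n + n) n 0.
Proof.
have -> : 0%N = weight (zerof (n + n)) by apply/esym/eqP; rewrite weight_eq0.
rewrite -sphere_sumE /sphere_sum (eq_bigr (fun=> 1)) => [|w _].
  rewrite (bigD1 (prefix_vec (n + n) n)) ?weight_prefix_vec ?leq_addr //=.
  by rewrite ltr_pwDl // sumr_ge0.
by rewrite walshC walsh0r.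
Qed.

Lemma krawtchouk1 n : (0 < n)%N -> krawtchouk (n + n) n 1 = 0.
Proof.
move=> n0; have := @krawtchouk_rec n 0 isT.
rewrite mul0r add0r subn0 => /eqP; rewrite mulf_eq0 pnatr_eq0 addn_eq0.
by case: n n0 => // n _ /= /eqP.
Qed.

Lemma krawtchouk2 n : (0 < n)%N ->
  ((n + n)%:R - 1) * krawtchouk (n + n) n 2 = - krawtchouk (n + n) n 0.
Proof.
move=> n0; have := @krawtchouk_rec n 1 (leq_trans n0 (leq_addr _ _)).
rewrite natrB ?(leq_trans n0 (leq_addr _ _)) //=; lra.
Qed.

Lemma norm_ratio_le (F : realFieldType) (p q a b : F) :
  0 <= p <= q -> 0 < q -> p * a + q * b = 0 -> `|b| <= `|a|.
Proof.
move=> /andP[p0 pq] q0 /eqP; rewrite addr_eq0 => /eqP ab.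
rewrite -(ler_pM2l q0) -{1}(gtr0_norm q0) -normrM -normrN -ab normrM.
rewrite ger0_norm //.
exact: ler_wpM2r.
Qed.

(** Write [N = n + n] and [D] for the value at [0]. The value at [3] inherits the zero at [1]; at
    [4] the left side is [3 * D / (N - 3)], and [N - 3 > 3]. Up to [n], each further step of two
    does not increase the modulus. *)
Lemma krawtchouk_lt n j : (3 < n)%N -> (3 <= j <= n)%N ->
  ((n + n)%:R - 1) * `|krawtchouk (n + n) n j| < krawtchouk (n + n) n 0.
Proof.
move=> n4; have D0 := krawtchouk0_gt0 n.
have K1 := @krawtchouk1 n ltac:(lia).
have K2 := @krawtchouk2 n ltac:(lia).
elim/ltn_ind: j => j IH /andP[].
case: j IH => [//|[//|[//|[|[|j]]]]] IH _ jn.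
- have := @krawtchouk_rec n 2 ltac:(lia).
  rewrite /= K1 mulr0 add0r => /eqP; rewrite mulf_eq0 pnatr_eq0.
  by case/orP => [|/eqP ->]; [lia|rewrite normr0 mulr0].
- have := @krawtchouk_rec n 3 ltac:(lia).
  rewrite /= natrB ?natrD; last by lia.
  have : 4 <= n%:R :> rat by rewrite ler_nat.
  move: D0 K2; rewrite natrD; set x := n%:R; set a := krawtchouk _ _ 2.
  set b := krawtchouk _ _ 4; set D := krawtchouk _ _ 0 => D0 K2 x4 rec.
  have a0 : a <= 0 by nra.
  have b0 : 0 <= b by nra.
  have c0 : 0 < x + x - 3 by lra.
  rewrite ger0_norm // -(ltr_pM2l c0) mulrCA.
  rewrite (_ : (x + x - 3) * b = - (3 * a)); last by lra.
  rewrite (_ : _ * - _ = 3 * D); last by lra.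
  by rewrite ltr_pM2r //; lra.
have := IH j.+3 ltac:(lia) ltac:(lia).
apply: le_lt_trans; rewrite ler_wpM2l //.
  by rewrite subr_ge0 (ler_nat _ 1); lia.
by apply: norm_ratio_le (@krawtchouk_rec n j.+4 _);
   rewrite ?ler0n ?ler_nat ?ltr0n; lia.
Qed.

(* [krawtchouk] gives the adjacency eigenvalues of the Hadamard graph;
   [krawtchouk (n + n) n 0] is its degree. *)
Lemma krawtchouk_gap n j : ~~ odd n -> (3 < n)%N -> (0 < j <= n + n)%N ->
  let gap := ((n + n)%:R - 1) * krawtchouk (n + n) n j +
             krawtchouk (n + n) n 0 in
  if (j == 2)%N || (j == n + n - 2)%N then gap = 0 else 0 < gap.
Proof.
move=> evn n4; wlog jn : j / (j <= n)%N => [IH /andP[j0 jN]|].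
  case: (leqP j n) => [jn|nj]; first by apply: IH => //; rewrite j0.
  (* Reflection sends [n + n] to the excluded index [0]; there the eigenvalue is the degree
     itself. *)
  have [->|jN'] := eqVneq j (n + n)%N.
    have -> : (n + n == 2)%N || (n + n == n + n - 2)%N = false by lia.
    have := @krawtchouk_sym n _ evn (leqnn _); rewrite subnn /= => <-.
    rewrite -[X in _ + X]mul1r -mulrDl subrK.
    by rewrite mulr_gt0 ?krawtchouk0_gt0 // ltr0n; lia.
  have := IH (n + n - j)%N ltac:(lia) ltac:(lia).
  rewrite krawtchouk_sym //.
  suff -> : (n + n - j == 2)%N || (n + n - j == n + n - 2)%N =
     (j == 2)%N || (j == n + n - 2)%N by [].
  lia.
move=> /andP[j0 _]; have D0 := krawtchouk0_gt0 n.
rewrite (_ : (j == n + n - 2)%N = false) ?orbF; last by lia.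
case: eqP => [->|j2]; first by rewrite krawtchouk2 ?addNr //; lia.
case: j j0 jn j2 => [//|[|[//|j]]] _ jn _.
  by rewrite krawtchouk1 ?mulr0 ?add0r //; lia.
have := @krawtchouk_lt n j.+3 n4 ltac:(lia).
have c0 : 0 <= (n + n)%:R - 1 :> rat by rewrite subr_ge0 (ler_nat _ 1); lia.
have := ler_wpM2l c0 (lerNnormlW (lexx `|krawtchouk (n + n) n j.+3|)).
by rewrite mulrN /= => h1 h2; lra.
Qed.

(** * Colour classes in a tight colouring *)

Definition colour_class N c (col : cube N -> 'I_c) (k : 'I_c) (x : cube N) :
  rat :=  (col x == k)%:R.

Lemma walsh_zerol N (x : cube N) : walsh (zerof N) x = 1.
Proof. by rewrite walshC walsh0r. Qed.

Lemma fourier0 N (f : cube N -> rat) : fourier f (zerof N) = \sum_x f x.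
Proof. by apply: eq_bigr => x _; rewrite walsh_zerol mulr1. Qed.

(** A 0/1-valued function equals its square, so its squared norm is the size of the class. *)
Lemma colour_class_parseval N c (col : cube N -> 'I_c) k :
  \sum_s fourier (colour_class col k) s ^+ 2 =
  (2 ^ N)%:R * fourier (colour_class col k) (zerof N).
Proof.
have := walsh_parseval (fun w => (w == zerof N)%:R) (colour_class col k).
rewrite (eq_bigr (fun s => fourier (colour_class col k) s ^+ 2)) => [->|s _].
  congr (_ * _); rewrite fourier0; apply: eq_bigr => x _.
  rewrite (bigD1 x) //= big1 => [|y yx]; rewrite xorf_eq0.
    by rewrite eqxx addr0 mulr1 /colour_class; case: eqP; rewrite ?mulr1 ?mulr0.
  by rewrite eq_sym (negbTE yx) mulr0.
rewrite (bigD1 (zerof N)) //= eqxx walsh0r big1 ?mulr1 ?addr0 ?mul1r // => w.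
by move=> /negbTE ->; rewrite mul0r.
Qed.

(** Up to a factor, the left side counts pairs at distance [n] inside a class. *)
Lemma colour_class_energy N n c (col : cube N -> 'I_c) k :
  (forall x y, weight (xorf x y) = n -> col x != col y) ->
  \sum_s sphere_sum n s * fourier (colour_class col k) s ^+ 2 = 0.
Proof.
move=> proper.
have := walsh_parseval (fun w => (weight w == n)%:R) (colour_class col k).
rewrite [X in _ * X]big1 ?mulr0 => [|x _]; last first.
  rewrite big1 // => y _; case: eqP => [/proper|_]; last by rewrite mulr0.
  rewrite /colour_class; case: (eqVneq (col x) k) => [->|];
    last by rewrite !mul0r.
  by rewrite eq_sym => /negbTE ->; rewrite mulr0 mul0r.
move=> energy0; rewrite -[RHS]energy0; apply: eq_bigr => s _; congr (_ * _).
rewrite /sphere_sum big_mkcond; apply: eq_bigr => w _.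
by case: eqP => _; rewrite ?mul1r ?mul0r.
Qed.

Lemma tight_colouring n (col : cube (n + n) -> 'I_(n + n)) k :
  ~~ odd n -> (3 < n)%N ->
  (forall x y, weight (xorf x y) = n -> col x != col y) ->
  (n + n)%:R * fourier (colour_class col k) (zerof _) ^+ 2 =
    (2 ^ (n + n))%:R * fourier (colour_class col k) (zerof _) /\
  forall s, s != zerof _ -> weight s != 2 -> weight s != (n + n - 2)%N ->
    fourier (colour_class col k) s = 0.
Proof.
move=> evn n4 proper; pose N := (n + n)%N.
pose F k s := fourier (colour_class col k) s.
pose D := krawtchouk N n 0; have D0 : 0 < D := krawtchouk0_gt0 n.
pose G (s : cube N) := (N%:R - 1) * sphere_sum n s + D.
have Ggap s : s != zerof N ->
    if (weight s == 2)%N || (weight s == N - 2)%N then G s = 0 else 0 < G s.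
  move=> s0; rewrite /G sphere_sumE; apply: krawtchouk_gap => //.
  by rewrite weight_le lt0n weight_eq0 s0.
have Gge0 s : s != zerof N -> 0 <= G s.
  by move=> /Ggap; case: ifP => _ => [->|/ltW].
(* The Hoffman bound with its defect: Parseval and the zero energy combined, with the term at
   [zerof N], where [G] is [N * D], moved to the right. *)
have GF l : \sum_(s | s != zerof N) G s * F l s ^+ 2 =
    D * ((2 ^ N)%:R * F l (zerof N) - N%:R * F l (zerof N) ^+ 2).
  have : \sum_s G s * F l s ^+ 2 = D * ((2 ^ N)%:R * F l (zerof N)).
    rewrite -colour_class_parseval (eq_bigr (fun s => (N%:R - 1) *
      (sphere_sum n s * F l s ^+ 2) + D * F l s ^+ 2)) => [|s _].
      by rewrite big_split /= -!mulr_sumr colour_class_energy // mulr0 add0r.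
    by rewrite /G; ring.
  rewrite (bigD1 (zerof N)) //= {1}/G sphere_sumE.
  rewrite (_ : weight (zerof N) = 0%N); last by apply/eqP; rewrite weight_eq0.
  rewrite -/D => sumG; lra.
have sumA : \sum_l F l (zerof N) = (2 ^ N)%:R.
  rewrite (eq_bigr (fun l => \sum_x colour_class col l x)) => [|l _].
    rewrite exchange_big /= (eq_bigr (fun=> 1)) => [|x _].
      by rewrite sumr_const card_ffun card_bool card_ord.
    rewrite (bigD1 (col x)) //= /colour_class eqxx big1 ?addr0 // => l.
    by rewrite eq_sym => /negbTE ->.
  by rewrite /F fourier0.
(* Nonnegativity of the variance of the [N] class sizes, whose mean is [2 ^ N / N]. Because there
   are exactly [N] colours, this bound is opposite to the Hoffman bound. *)
have cauchy : (2 ^ N)%:R ^+ 2 <= N%:R * \sum_l F l (zerof N) ^+ 2.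
  have N0 : 0 < N%:R :> rat by rewrite ltr0n /N; lia.
  rewrite -(ler_pM2l N0) -subr_ge0.
  have : 0 <= \sum_l (N%:R * F l (zerof N) - (2 ^ N)%:R) ^+ 2.
    by apply: sumr_ge0 => l _; apply: sqr_ge0.
  rewrite (eq_bigr (fun l => N%:R ^+ 2 * F l (zerof N) ^+ 2 -
    (2 * N%:R * (2 ^ N)%:R) * F l (zerof N) + (2 ^ N)%:R ^+ 2)) => [|l _];
    last by ring.
  have sum_const : \sum_(l < N) (2 ^ N)%:R ^+ 2 = N%:R * (2 ^ N)%:R ^+ 2 :> rat.
    by rewrite sumr_const card_ord mulr_natl.
  rewrite big_split sumrB /= sum_const -!mulr_sumr sumA.
  by move=> h; lra.
have sum_le0 : \sum_l \sum_(s | s != zerof N) G s * F l s ^+ 2 <= 0.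
  rewrite (eq_bigr _ (fun l _ => GF l)) -mulr_sumr sumrB -!mulr_sumr sumA.
  by rewrite -expr2 pmulr_rle0 // subr_le0.
have inner_ge0 l : 0 <= \sum_(s | s != zerof N) G s * F l s ^+ 2.
  by apply: sumr_ge0 => s /Gge0 Gs; rewrite mulr_ge0 ?sqr_ge0.
have inner0 : \sum_(s | s != zerof N) G s * F k s ^+ 2 = 0.
  apply: (psumr_eq0P (P := xpredT)
    (F := fun l => \sum_(s | s != zerof N) G s * F l s ^+ 2)) => //.
  by apply/eqP; rewrite eq_le sum_le0 sumr_ge0.
split.
  move: (GF k); rewrite inner0 => /esym/eqP.
  rewrite mulf_eq0 gt_eqF //= subr_eq0.
  by move/eqP.
move=> s s0 s2 sN2.
have : G s * F k s ^+ 2 = 0.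
  apply: (psumr_eq0P (P := fun s => s != zerof N)
    (F := fun s => G s * F k s ^+ 2)) => // t /Gge0 Gt.
  by rewrite mulr_ge0 ?sqr_ge0.
have := Ggap s s0; rewrite (negbTE s2) (negbTE sN2) => /= Gs /eqP.
by rewrite mulf_eq0 gt_eqF //= sqrf_eq0 => /eqP.
Qed.

(** * Degree and support on cosets *)

(** The terms are indexed by the sublists of [E], so that each direction splits the sum into two
    halves. *)
Fixpoint coset_sum N (E : seq (cube N)) (g : cube N -> rat) (x : cube N) :
    rat :=
  if E is e :: E' then coset_sum E' g x + coset_sum E' g (xorf x e) else g x.

Definition diff_along N (e : cube N) (g : cube N -> rat) (x : cube N) : rat :=
  g (xorf x e) - g x.

(* [g] has degree less than [k] in the coordinates [E] of the coset
   [x + <E>]. *)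
Fixpoint deg_lt N k (E : seq (cube N)) (g : cube N -> rat) (x : cube N) :
    Prop :=
  match E, k with
  | [::], 0 => g x = 0
  | [::], _.+1 => True
  | e :: E', 0 => deg_lt 0 E' g x /\ deg_lt 0 E' g (xorf x e)
  | e :: E', k'.+1 => [/\ deg_lt k E' g x, deg_lt k E' g (xorf x e)
                        & deg_lt k' E' (diff_along e g) x]
  end.

Definition nonzero N (g : cube N -> rat) (x : cube N) : rat := (g x != 0)%:R.

Lemma coset_sumD N (E : seq (cube N)) g h x :
  coset_sum E (fun y => g y + h y) x = coset_sum E g x + coset_sum E h x.
Proof. by elim: E x => //= e E IH x; rewrite !IH addrACA. Qed.

Lemma coset_sum_shift N (E : seq (cube N)) e g x :
  coset_sum E (fun y => g (xorf y e)) x = coset_sum E g (xorf x e).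
Proof.
elim: E x => //= d E IH x; rewrite !IH.
by rewrite -!xorfA (xorfC d).
Qed.

Lemma ler_coset_sum N (E : seq (cube N)) g h x :
  (forall y, g y <= h y) -> coset_sum E g x <= coset_sum E h x.
Proof. by move=> gh; elim: E x => //= e E IH x; rewrite lerD. Qed.

Lemma coset_sum_ge0 N (E : seq (cube N)) g x :
  (forall y, 0 <= g y) -> 0 <= coset_sum E g x.
Proof. by move=> g0; elim: E x => //= e E IH x; rewrite addr_ge0. Qed.

Lemma coset_sum_ge N (E : seq (cube N)) g x :
  (forall y, 0 <= g y) -> g x <= coset_sum E g x.
Proof.
by move=> g0; elim: E x => //= e E IH x; rewrite ler_wpDr ?coset_sum_ge0.
Qed.

Lemma deg_lt0 N (E : seq (cube N)) g x :
  deg_lt 0 E g x -> coset_sum E (nonzero g) x = 0.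
Proof.
elim: E x => /= [x gx0|e E IH x [/IH -> /IH ->]]; last by rewrite addr0.
by rewrite /nonzero gx0 eqxx.
Qed.

(* Schwartz-Zippel on the cube: in each direction, either both halves of the
   support are nonempty, or the difference has the same support and lower
   degree. *)
Lemma deg_lt_support N k (E : seq (cube N)) g x :
  deg_lt k.+1 E g x -> coset_sum E (nonzero g) x != 0 ->
  (2 ^ size E)%:R <= (2 ^ k)%:R * coset_sum E (nonzero g) x.
Proof.
have nz0 (h : cube N -> rat) y : 0 <= nonzero h y by rewrite /nonzero ler0n.
(* Of two values and their difference, it is impossible that exactly one is nonzero. *)
have nz_le (e : cube N) (h : cube N -> rat) y :
  [/\ nonzero (diff_along e h) y <= nonzero h y + nonzero h (xorf y e),
      nonzero h y <= nonzero (diff_along e h) y + nonzero h (xorf y e)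
    & nonzero h (xorf y e) <= nonzero (diff_along e h) y + nonzero h y].
  rewrite /nonzero /diff_along; move: (h _) (h y) => a b.
  have [->|a0] := eqVneq a 0; have [->|b0] := eqVneq b 0.
  - by rewrite subr0 eqxx /=; split; lra.
  - by rewrite sub0r oppr_eq0 b0 /=; split; lra.
  - by rewrite subr0 a0 /=; split; lra.
  - by case: (_ != _) => /=; split; lra.
elim: E k g x => /= [|e E IH] k g x.
  move=> _; rewrite /nonzero pnatr_eq0 eqb0 negbK => ->.
  by rewrite mulr1 ler_nat expn_gt0.
case=> deg1 deg2 degd.
have S1 := coset_sum_ge0 E x (nz0 g).
have S2 := coset_sum_ge0 E (xorf x e) (nz0 g).
have [d1 d2 d3] : let S := coset_sum E (nonzero (diff_along e g)) x in
  let S1 := coset_sum E (nonzero g) x in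
  let S2 := coset_sum E (nonzero g) (xorf x e) in
  [/\ S <= S1 + S2, S1 <= S + S2 & S2 <= S + S1].
  rewrite /= -(coset_sum_shift E e (nonzero g) x) -!coset_sumD.
  by split; apply: ler_coset_sum => y; have [] := nz_le e g y.
rewrite expnS natrM.
have [/andP[S1n S2n] _|] := boolP ((coset_sum E (nonzero g) x != 0) &&
    (coset_sum E (nonzero g) (xorf x e) != 0)).
  by have := IH _ _ _ deg1 S1n; have := IH _ _ _ deg2 S2n; lra.
rewrite negb_and !negbK => half_zero S12.
(* When one half vanishes, the three triangle inequalities become equalities. *)
have Sd : coset_sum E (nonzero (diff_along e g)) x =
    coset_sum E (nonzero g) x + coset_sum E (nonzero g) (xorf x e).
  by case/orP: half_zero => /eqP; lra.
case: k deg1 deg2 degd => [|k] _ _ degd.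
  by move: S12; rewrite -Sd (deg_lt0 degd) eqxx.
by have := IH _ _ _ degd; rewrite Sd => /(_ S12); rewrite expnS natrM; lra.
Qed.

(** Differencing along [e] multiplies the coefficient of [s] by [walsh s e - 1]: characters trivial
    on [e] disappear, and the others have one nontrivial direction fewer left. *)
Lemma walsh_expansion_deg_lt N k (E : seq (cube N)) (a : cube N -> rat) g x :
  g =1 (fun y => \sum_s a s * walsh s y) ->
  (forall s, a s != 0 -> (count (fun e => walsh s e != 1%R) E < k)%N) ->
  deg_lt k E g x.
Proof.
elim: E k a g x => [|e E IH] [|k] a g x gE ak //=.
- by rewrite gE big1 // => s _; have [->|/ak] := eqVneq (a s) 0; rewrite ?mul0r.
- by split; apply: (IH _ a) => // s /ak.
have akE s : a s != 0 -> (count (fun e => walsh s e != 1%R) E < k.+1)%N.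
  by move=> /ak /=; apply: leq_ltn_trans; rewrite leq_addl.
split; [exact: (IH _ a) | exact: (IH _ a) |].
apply: (IH _ (fun s => a s * (walsh s e - 1))) => [y|s].
  rewrite /diff_along !gE -sumrB; apply: eq_bigr => s _.
  by rewrite walsh_xorr; ring.
rewrite mulf_eq0 negb_or subr_eq0 => /andP[/ak /= + we].
by rewrite we add1n ltnS.
Qed.

(** The product keeps only the characters that are trivial on every direction of [E]. *)
Lemma walsh_expansion_coset_sum N (E : seq (cube N)) (a : cube N -> rat) g x :
  g =1 (fun y => \sum_s a s * walsh s y) ->
  coset_sum E g x = \sum_s a s * walsh s x * \prod_(e <- E) (1 + walsh s e).
Proof.
move=> gE; elim: E x => /= [|e E IH] x.
  by rewrite gE; apply: eq_bigr => s _; rewrite big_nil mulr1.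
rewrite !IH -big_split; apply: eq_bigr => s _ /=.
by rewrite big_cons walsh_xorr; ring.
Qed.

(** * No colouring with N colours *)

Definition pair_vec n (i : 'I_n) : cube (n + n) :=
  xorf (unit_vec (lshift n i)) (unit_vec (rshift n i)).

Definition pair_vecs n : seq (cube (n + n)) :=
  [seq pair_vec i | i <- enum 'I_n].

Lemma walsh_pair_vec n (s : cube (n + n)) i :
  walsh s (pair_vec i) = (-1) ^+ (s (lshift n i) (+) s (rshift n i)).
Proof. by rewrite walsh_xorr !(walshC s) !walsh_unit_vec signr_addb. Qed.

Lemma walsh_pair_vec_eq1 n (s : cube (n + n)) i :
  (walsh s (pair_vec i) == 1) = (s (lshift n i) == s (rshift n i)).
Proof. by rewrite walsh_pair_vec; case: (s _) (s _) => [] []. Qed.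

Lemma walsh_half n (s : cube (n + n)) :
  walsh s (prefix_vec (n + n) n) = (-1) ^+ (\sum_i s (lshift n i))%N.
Proof.
rewrite /walsh big_split_ord /= [X in _ * X]big1 ?mulr1 => [|i _]; last first.
  by rewrite ffunE /= ltnNge leq_addr andbF.
by rewrite expr_sum; apply: eq_bigr => i _; rewrite ffunE /= ltn_ord andbT.
Qed.

(** A pair on which [s] is not constant uses up one coordinate where [s] is true and one where it is
    false. This turns the support in weights [0], [2], [N - 2] into degree at most 2. *)
Lemma count_pair_vecs n (s : cube (n + n)) :
  (count (fun e => walsh s e != 1%R) (pair_vecs n) <=
    minn (weight s) (n + n - weight s))%N.
Proof.
have -> : count (fun e => walsh s e != 1%R) (pair_vecs n) =
    (\sum_i (s (lshift n i) != s (rshift n i)))%N.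
  rewrite count_map -sum1_count big_enum_cond /= big_mkcond /=.
  by apply: eq_bigr => i _; rewrite walsh_pair_vec_eq1; case: eqP.
rewrite leq_min -weight_compl /weight !big_split_ord /= -!big_split /=.
by apply/andP; split; apply: leq_sum => i _; case: (s _) (s _) => [] [].
Qed.

(* A character of weight [2] or [N - 2] that is trivial on all pairs is a
   single pair or its complement, hence changes sign under the half flip. *)
Lemma walsh_pairs_half n (s : cube (n + n)) :
  ~~ odd n -> (0 < n)%N -> (weight s == 2%N) || (weight s == n + n - 2)%N ->
  (1 + walsh s (prefix_vec (n + n) n)) *
    \prod_(e <- pair_vecs n) (1 + walsh s e) = 0.
Proof.
move=> evn n0 ws; rewrite big_map.
have [|trivial] := boolP [exists i, s (lshift n i) != s (rshift n i)].
  case/existsP => i si; rewrite (bigD1_seq i) ?mem_enum ?enum_uniq //=.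
  by rewrite walsh_pair_vec -negb_eqb si expr1 subrr mul0r mulr0.
rewrite walsh_half -signr_odd.
suff -> : odd (\sum_i s (lshift n i)) by rewrite expr1 subrr mul0r.
have w2 : weight s = ((\sum_i s (lshift n i)).*2)%N.
  rewrite /weight big_split_ord /= -addnn; congr addn; apply: eq_bigr => i _.
  by move/existsPn: trivial => /(_ i); rewrite negbK => /eqP ->.
(* Here [k] is [1] or [n - 1], odd because [n] is even. *)
move: ws evn; rewrite w2; set k := (\sum_i _)%N => ws evn; lia.
Qed.

Lemma hadamard_not_colourable n (col : cube (n + n) -> 'I_(n + n)) :
  ~~ odd n -> (4 < n)%N ->
  ~ (forall x y, weight (xorf x y) = n -> col x != col y).
Proof.
move=> evn n5 proper; pose N := (n + n)%N; pose x0 := zerof N.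
pose f := colour_class col (col x0).
pose a (s : cube N) := fourier f s / (2 ^ N)%:R.
have [mean spec] := tight_colouring (col x0) evn (ltnW n5) proper.
have P0 : 0 < (2 ^ N)%:R :> rat by rewrite ltr0n expn_gt0.
have fE : f =1 (fun x => \sum_s a s * walsh s x).
  move=> x; rewrite (eq_bigr (fun s => (fourier f s * walsh s x) / (2 ^ N)%:R)).
    by rewrite -mulr_suml fourier_inversion mulrAC mulfV ?mul1r // gt_eqF.
  by move=> s _; rewrite /a mulrAC.
have f0 y : 0 <= f y by rewrite /f /colour_class ler0n.
have nzf y : nonzero f y = f y.
  by rewrite /nonzero /f /colour_class; case: (col y == _);
     rewrite ?oner_eq0 ?eqxx.
have fx0 : f x0 = 1 by rewrite /f /colour_class eqxx.
have a_spec s : a s != 0 ->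
    [|| s == zerof N, weight s == 2%N | weight s == N - 2]%N.
  move=> as0; apply: contraNT as0; rewrite !negb_or => /and3P[s0 s2 sN].
  by rewrite /a /f spec // mul0r.
have degf : deg_lt 3 (pair_vecs n) f x0.
  apply: (@walsh_expansion_deg_lt _ _ _ a _ _ fE) => s /a_spec s_spec.
  apply: leq_ltn_trans (count_pair_vecs s) _.
  case/or3P: s_spec => [/eqP ->|/eqP ->|/eqP ->]; rewrite /N; try lia.
  have /eqP -> : weight (zerof N) == 0%N by rewrite weight_eq0.
  by rewrite min0n.
have S1 : f x0 <= coset_sum (pair_vecs n) f x0 by apply: coset_sum_ge.
have nzS : coset_sum (pair_vecs n) (nonzero f) x0 =
    coset_sum (pair_vecs n) f x0.
  by apply/eqP; rewrite eq_le !ler_coset_sum // => y; rewrite nzf.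
have support : (2 ^ n)%:R <= 4 * coset_sum (pair_vecs n) f x0.
  have := deg_lt_support degf; rewrite nzS size_map size_enum_ord; apply.
  by rewrite gt_eqF // (lt_le_trans _ S1) // fx0.
pose h := prefix_vec N n.
(* Only the trivial character survives on the union of the two cosets; it contributes a factor 2 for
   [h] and for each pair. *)
have : coset_sum (h :: pair_vecs n) f x0 = a (zerof N) * 2 * (2 ^ n)%:R.
  rewrite (walsh_expansion_coset_sum _ _ fE) (bigD1 (zerof N)) //=.
  rewrite [X in _ + X]big1 => [|s s0].
    rewrite addr0 walsh_zerol mulr1 big_cons walsh_zerol -mulrA.
    congr (_ * (_ * _)).
    rewrite big_map (eq_bigr (fun=> 2)) => [|i _]; last by rewrite walsh_zerol.
    by rewrite big_const_seq count_predT size_enum_ord natrX -Monoid.iteropE.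
  have [->|/a_spec] := eqVneq (a s) 0; first by rewrite !mul0r.
  rewrite (negbTE s0) /= => ws.
  by rewrite big_cons walsh_pairs_half ?mulr0 //; lia.
rewrite /=; have := coset_sum_ge0 (pair_vecs n) (xorf x0 h) f0.
have A0 : 0 < fourier f (zerof N).
  by rewrite fourier0 (bigD1 x0) //= fx0 ltr_pwDl // sumr_ge0.
have -> : a (zerof N) = N%:R^-1.
  have N0 : N%:R != 0 :> rat by rewrite pnatr_eq0 /N; lia.
  move: mean; rewrite -/f -/N expr2 mulrA => /(mulIf (lt0r_neq0 A0)) NA.
  by apply: (mulfI N0); rewrite mulrA NA !mulfV // gt_eqF.
have q0 : 0 < (2 ^ n)%:R :> rat by rewrite ltr0n expn_gt0.
have N10 : 10 <= N%:R :> rat by rewrite ler_nat /N; lia.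
have : N%:R^-1 <= 10^-1 :> rat by rewrite lef_pV2 // posrE; lra.
(* The coset sum at [x0] is at least [2 ^ n / 4] and at most [2 * 2 ^ n / N], hence at most
   [2 ^ n / 5]. *)
nra.
Qed.

(** * Classical protocols *)

Lemma measurable_winning (R : realType) (V : finType) c
    (p : classical_protocol R V c) a b :
  measurable [set w | winning a b (calice p a w) (cbob p b w)]%classic.
Proof.
rewrite (_ : [set w | _]%classic =
    (\bigcup_(kl in [set kl : 'I_c * 'I_c | winning a b kl.1 kl.2])
      ([set w | calice p a w = kl.1] `&` [set w | cbob p b w = kl.2]))%classic).
  apply: fin_bigcup_measurable => [|kl _]; first exact: finite_finset.
  by apply: measurableI; [exact: calice_measurable|exact: cbob_measurable].
apply/seteqP; split => w /=.
  by exists (calice p a w, cbob p b w).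
by case=> [[k l]] /= win [-> ->].
Qed.

(** There are finitely many question pairs, each won almost surely, so almost every [w] wins them
    all; total mass 1 makes such a [w] exist. *)
Lemma classical_successful_deterministic (R : realType) (V : finType)
    (e : rel V) c (p : classical_protocol R V c) :
  classical_successful e p ->
  exists w, forall a b, allowed e a b ->
    winning a b (calice p a w) (cbob p b w).
Proof.
move=> success; pose mu := info_law p.
have mu_proper : ProperFilter (almost_everywhere mu).
  apply: ae_properfilter_algebraOfSetsType.
  by rewrite [X in (0 < X)%E](probability_setT mu) lte01.
suff near_win : \forall w \near almost_everywhere mu, forall a b,
    allowed e a b -> winning a b (calice p a w) (cbob p b w).
  by have [w ?] := filter_ex near_win; exists w.
apply: filter_forall => a; apply: filter_forall => b.
have [ab|nab] := boolP (allowed e a b); last exact: filterE.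
have mW := measurable_winning p a b.
exists (~` [set w | winning a b (calice p a w) (cbob p b w)])%classic; split.
- exact: measurableC.
- have /= := success a b ab; rewrite /classical_win_prob => PW.
  by rewrite /mu [LHS]probability_setC // PW subee.
- by move=> w /=; apply: contra_not => win _.
Qed.

(** * The quantum protocol *)

(** The polynomial ['X^n - 1] splits and is separable, so it has [n] distinct roots; [n] distinct
    [n]-th roots of unity include a primitive one. *)
Lemma prim_root_exists (C : numClosedFieldType) n :
  (0 < n)%N -> exists z : C, n.-primitive_root z.
Proof.
pose p : {poly C} := 'X^n - 1; have [r Dp] := closed_field_poly_normal p.
move=> n0; rewrite (monicP _) ?monicXnsubC // scale1r in Dp.
have rn1 : all n.-unity_root r by apply/allP => z; rewrite -root_prod_XsubC -Dp.
have sz_r : (n < (size r).+1)%N.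
  by rewrite -(size_prod_XsubC r id) -Dp size_XnsubC.
have [|z] := hasP (cyclic.has_prim_root n0 rn1 _ sz_r); last by exists z.
by rewrite -separable.separable_prod_XsubC -Dp cyclotomic.separable_Xn_sub_1 //
  pnatr_eq0 -lt0n.
Qed.

Lemma conj_unity_root (C : numClosedFieldType) n (z : C) :
  (0 < n)%N -> z ^+ n = 1 -> z * z^* = 1.
Proof.
move=> n0 zn; rewrite -normCK.
have /eqP : `|z| ^+ n = 1 by rewrite -normrX zn normr1.
by rewrite pexpr_eq1 // => /eqP ->; rewrite expr1n.
Qed.

Lemma sum_unity_root (F : fieldType) n (u : F) :
  u ^+ n = 1 -> u != 1 -> \sum_(k < n) u ^+ k = 0.
Proof.
move=> un u1; apply/eqP; have /eqP := subrX1 u n.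
by rewrite un subrr eq_sym mulf_eq0 subr_eq0 (negbTE u1).
Qed.

Lemma sum_prim_root_conj (C : numClosedFieldType) n (z : C) (i j : 'I_n) :
  n.-primitive_root z ->
  \sum_(k < n) (z ^+ i * (z ^+ j)^*) ^+ k = n%:R *+ (i == j).
Proof.
move=> prim; have n0 := prim_order_gt0 prim.
have zjn : (z ^+ j) ^+ n = 1 by rewrite exprAC (prim_expr_order prim) expr1n.
have zj := conj_unity_root n0 zjn.
have [->|ij] := eqVneq i j.
  rewrite zj (eq_bigr (fun=> 1)) => [|k _]; last by rewrite expr1n.
  by rewrite sumr_const card_ord.
apply: sum_unity_root.
  rewrite exprMn -rmorphXn zjn rmorph1 mulr1.
  by rewrite exprAC (prim_expr_order prim) expr1n.
apply: contra_neq ij => zij; apply/val_inj => /=.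
have /eqP : z ^+ i = z ^+ j.
  by rewrite -[LHS]mulr1 -zj mulrCA zij mulr1.
by rewrite (eq_prim_root_expr prim) !modn_small // => /eqP.
Qed.

Definition rank1 (C : numClosedFieldType) n (c : C) (v : 'cV[C]_n) : 'M[C]_n :=
  c *: (v *m v ^t*).

Lemma rank1E (C : numClosedFieldType) n (c : C) (v : 'cV[C]_n) i j :
  rank1 c v i j = c * (v i 0 * (v j 0)^*).
Proof. by rewrite !mxE big_ord1 !mxE. Qed.

Lemma rank1_form_ge0 (C : numClosedFieldType) n (c : C) (v u : 'cV[C]_n) :
  0 <= c -> 0 <= (u ^t* *m rank1 c v *m u) 0 0.
Proof.
move=> c0; rewrite /rank1 -scalemxAr -scalemxAl mxE mulr_ge0 //.
rewrite mulmxA -(mulmxA (_ *m v)) mxE big_ord1.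
have -> : (v ^t* *m u) 0 0 = ((u ^t* *m v) 0 0)^*.
  rewrite !mxE rmorph_sum; apply: eq_bigr => i _.
  by rewrite !mxE rmorphM /= conjCK mulrC.
exact: mul_conjC_ge0.
Qed.

Lemma psdmx_rank1 (R : realType) n (c : R[i]) (v : 'cV[R[i]]_n) :
  0 <= c -> psdmx (rank1 c v).
Proof. by move=> c0 u; apply: rank1_form_ge0. Qed.

Lemma sum_mxtens (V : nmodType) m n (F : 'I_(m * n) -> V) :
  \sum_q F q = \sum_i \sum_j F (mxtens_index (i, j)).
Proof.
rewrite pair_big (reindex (@mxtens_index m n)) /=; last first.
  exists (@mxtens_unindex m n) => q _;
    [exact: mxtens_indexK|exact: mxtens_unindexK].
by apply: eq_bigr => [] [].
Qed.

(** The unnormalised maximally entangled vector; the scalar of [rank1] normalises the state, which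
    avoids square roots. *)
Definition diag_vec (C : numClosedFieldType) n : 'cV[C]_(n * n) :=
  \col_q ((mxtens_unindex q).1 == (mxtens_unindex q).2)%:R.

Definition max_entangled (C : numClosedFieldType) n : 'M[C]_(n * n) :=
  rank1 n%:R^-1 (diag_vec C n).

Lemma max_entangledE (C : numClosedFieldType) n i i' j j' :
  max_entangled C n (mxtens_index (i, i')) (mxtens_index (j, j')) =
  n%:R^-1 * ((i == i')%:R * (j == j')%:R).
Proof. by rewrite rank1E !mxE !mxtens_indexK /= conjC_nat. Qed.

Lemma tr_max_entangled (C : numClosedFieldType) n :
  (0 < n)%N -> \tr (max_entangled C n) = 1.
Proof.
move=> n0; rewrite /mxtrace sum_mxtens (eq_bigr (fun=> n%:R^-1)) => [|i _].
  by rewrite sumr_const card_ord -[LHS]mulr_natl mulfV // pnatr_eq0 -lt0n.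
rewrite (bigD1 i) //= max_entangledE eqxx !mulr1 big1 ?addr0 // => j ji.
by rewrite max_entangledE eq_sym (negbTE ji) !mulr0.
Qed.

(** The double sum is the trace of [P] times the transpose of [Q]. For Hermitian effects,
    conjugating Bob's cancels this transpose. *)
Lemma tr_tens_max_entangled (C : numClosedFieldType) n (P Q : 'M[C]_n) :
  \tr ((P *t Q) *m max_entangled C n) =
  n%:R^-1 * \sum_i \sum_j P i j * Q i j.
Proof.
have diag (i : 'I_n) (F : 'I_n -> C) : 
    \sum_j F j * (i == j)%:R = F i.
  rewrite (bigD1 i) //= eqxx mulr1 big1 ?addr0 // => j.
  by rewrite eq_sym => /negbTE ->; rewrite mulr0.
rewrite /mxtrace sum_mxtens mulr_sumr; apply: eq_bigr => i _.
transitivity (\sum_i' (\sum_j n%:R^-1 * (P i j * Q i' j)) * (i == i')%:R).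
  apply: eq_bigr => i' _; rewrite mxE sum_mxtens mulr_suml.
  apply: eq_bigr => j _.
  rewrite -[RHS](diag j (fun j' => n%:R^-1 * (P i j * Q i' j') * (i == i')%:R)).
  apply: eq_bigr => j' _; rewrite tensmxE max_entangledE.
  by ring.
by rewrite diag mulr_sumr.
Qed.

Definition phase_vec (C : numClosedFieldType) N (z : C) (a : cube N)
    (k : 'I_N) :
  'cV[C]_N := \col_i ((-1) ^+ a i * z ^+ (i * k)).

Definition effectA (C : numClosedFieldType) N (z : C) (a : cube N) (k : 'I_N) :=
  rank1 N%:R^-1 (phase_vec z a k).

Definition effectB (C : numClosedFieldType) N (z : C) (b : cube N) (l : 'I_N) :=
  rank1 N%:R^-1 (map_mx Num.conj (phase_vec z b l)).

Lemma conj_phase_vec (C : numClosedFieldType) N (z : C) (a : cube N) k i :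
  (phase_vec z a k i 0)^* = (-1) ^+ a i * (z ^+ (i * k))^*.
Proof. by rewrite mxE rmorphM rmorph_sign. Qed.

Lemma sum_effectA (C : numClosedFieldType) N (z : C) (a : cube N) :
  N.-primitive_root z -> \sum_k effectA z a k = 1%:M.
Proof.
move=> prim; have N0 : N%:R != 0 :> C.
  by rewrite pnatr_eq0 -lt0n (prim_order_gt0 prim).
apply/matrixP => i j; rewrite summxE mxE.
rewrite (eq_bigr (fun k : 'I_N => N%:R^-1 * ((-1) ^+ a i * (-1) ^+ a j) *
    (z ^+ i * (z ^+ j)^*) ^+ k)) => [|k _].
  rewrite -mulr_sumr sum_prim_root_conj //.
  have [->|_] := eqVneq i j; last by rewrite mulr0.
  by rewrite -expr2 sqrr_sign mulr1 mulVf.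
rewrite rank1E conj_phase_vec mxE exprMn -rmorphXn -!exprM.
by ring.
Qed.

Lemma effectBE (C : numClosedFieldType) N (z : C) (b : cube N) l :
  effectB z b l = map_mx Num.conj (effectA z b l).
Proof.
apply/matrixP => i j; rewrite [RHS]mxE !rank1E !rmorphM fmorphV rmorph_nat.
by rewrite ![map_mx _ _ _ _]mxE.
Qed.

Lemma sum_effectB (C : numClosedFieldType) N (z : C) (b : cube N) :
  N.-primitive_root z -> \sum_l effectB z b l = 1%:M.
Proof.
move=> prim; rewrite (eq_bigr _ (fun l _ => effectBE z b l)) -map_mx_sum.
by rewrite sum_effectA // map_mx1.
Qed.

(** The probability is the squared modulus of the amplitude, divided by [N ^ 3]. *)
Lemma effect_overlap (C : numClosedFieldType) N (z : C) (a b : cube N) k l :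
  \sum_i phase_vec z a k i 0 * (phase_vec z b l i 0)^* = 0 ->
  \tr ((effectA z a k *t effectB z b l) *m max_entangled C N) = 0.
Proof.
move=> ortho; rewrite tr_tens_max_entangled.
suff -> : \sum_i \sum_j effectA z a k i j * effectB z b l i j = 0.
  by rewrite mulr0.
transitivity (N%:R^-1 * N%:R^-1 *
   ((\sum_i phase_vec z a k i 0 * (phase_vec z b l i 0)^*) *
    \sum_j (phase_vec z a k j 0)^* * phase_vec z b l j 0)); last first.
  by rewrite ortho mul0r mulr0.
rewrite mulr_suml mulr_sumr; apply: eq_bigr => i _.
rewrite 2!mulr_sumr; apply: eq_bigr => j _.
by rewrite !rank1E ![map_mx _ _ _ _]mxE conjCK; ring.
Qed.

Lemma tr_effects_sum (C : numClosedFieldType) N (z : C) (a b : cube N) :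
  N.-primitive_root z ->
  \sum_k \sum_l \tr ((effectA z a k *t effectB z b l) *m max_entangled C N) = 1.
Proof.
move=> prim; have N0 : N%:R != 0 :> C.
  by rewrite pnatr_eq0 -lt0n (prim_order_gt0 prim).
transitivity (N%:R^-1 * \sum_i \sum_j
    (\sum_k effectA z a k) i j * (\sum_l effectB z b l) i j).
  rewrite mulr_sumr (eq_bigr (fun k => \sum_i \sum_j N%:R^-1 *
     (effectA z a k i j * (\sum_l effectB z b l) i j))) => [|k _].
    rewrite exchange_big; apply: eq_bigr => i _.
    rewrite exchange_big mulr_sumr; apply: eq_bigr => j _.
    by rewrite -mulr_sumr -mulr_suml !summxE.
  rewrite (eq_bigr _ (fun l _ => tr_tens_max_entangled _ _)) -mulr_sumr.
  rewrite exchange_big mulr_sumr; apply: eq_bigr => i _.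
  rewrite exchange_big mulr_sumr; apply: eq_bigr => j _.
  by rewrite -mulr_sumr summxE.
rewrite sum_effectA // sum_effectB // (eq_bigr (fun=> 1)) => [|i _].
  by rewrite sumr_const card_ord mulVf.
rewrite (bigD1 i) //= mxE eqxx mulr1 big1 ?addr0 // => j ji.
by rewrite mxE eq_sym (negbTE ji) mul0r.
Qed.

(** On equal questions the signs cancel and distinct answers are orthogonal Fourier modes. On
    adjacent questions with equal answers the phases cancel, leaving [n] signs of each kind. *)
Lemma losing_amplitude (C : numClosedFieldType) n (z : C)
    (a b : cube (n + n)) k l :
  (n + n)%N.-primitive_root z ->
  (a == b) || (weight (xorf a b) == n) -> ~~ winning a b k l ->
  \sum_i phase_vec z a k i 0 * (phase_vec z b l i 0)^* = 0.
Proof.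
move=> prim; have n0 := prim_order_gt0 prim.
rewrite /winning; case: (eqVneq a b) => [<- _|ab /=] /=; last first.
  rewrite orbF negbK => /eqP wn /eqP <-.
  rewrite (eq_bigr (fun i => (-1) ^+ xorf a b i)) => [|i _].
    by rewrite (sum_sign C) wn mulr2n -natrD subrr.
  have zik : (z ^+ (i * k)) ^+ (n + n) = 1.
    by rewrite exprAC (prim_expr_order prim) expr1n.
  rewrite conj_phase_vec mxE mulrACA (conj_unity_root n0 zik) mulr1.
  by rewrite ffunE signr_addb.
move=> kl; rewrite (eq_bigr (fun i : 'I_(n + n) => (z ^+ k * (z ^+ l)^*) ^+ i)).
  by rewrite sum_prim_root_conj // (negbTE kl).
move=> i _; rewrite conj_phase_vec mxE mulrACA -expr2 sqrr_sign mul1r.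
by rewrite exprMn -rmorphXn -!exprM !(mulnC i).
Qed.

Lemma invn_ge0 (C : numClosedFieldType) n : 0 <= n%:R^-1 :> C.
Proof. by rewrite invr_ge0 ler0n. Qed.

Definition measurementA (R : realType) N (z : R[i]) (prim : N.-primitive_root z)
    (a : cube N) : measurement R N :=
  Measurement (fun k => psdmx_rank1 (phase_vec z a k) (invn_ge0 _ N))
    (sum_effectA a prim).

Definition measurementB (R : realType) N (z : R[i]) (prim : N.-primitive_root z)
    (b : cube N) : measurement R N :=
  Measurement (fun l => psdmx_rank1 (map_mx Num.conj (phase_vec z b l))
      (invn_ge0 _ N))
    (sum_effectB b prim).

Definition max_entangled_state (R : realType) N (z : R[i])
    (prim : N.-primitive_root z) : quantum_state R (N * N) :=
  QState (psdmx_rank1 (diag_vec _ N) (invn_ge0 _ N))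
    (tr_max_entangled _ (prim_order_gt0 prim)).

Definition fourier_protocol (R : realType) N (z : R[i])
    (prim : N.-primitive_root z) : quantum_protocol R (cube N) N :=
  @Quantum R (cube N) N N N (max_entangled_state prim) (measurementA prim)
    (measurementB prim) (fun _ k => k) (fun _ l => l).

Lemma fourier_protocol_successful (R : realType) n (z : R[i])
    (prim : (n + n)%N.-primitive_root z) :
  quantum_successful (hadamard_graph (n + n)) (fourier_protocol prim).
Proof.
have half : ((n + n) %/ 2 = n)%N by lia.
move=> a b; rewrite /allowed /hadamard_graph hamming_xorf half => edge.
(* With [1] written as the total probability, it remains to see that the losing terms vanish. *)
rewrite -(tr_effects_sum a b prim); apply: eq_bigr => k _.
rewrite big_mkcond; apply: eq_bigr => l _.
have [//|lose] := boolP (winning a b _ _).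
by rewrite effect_overlap // (losing_amplitude prim edge lose).
Qed.

Theorem theorem3p3 (R : realType) (m : nat) (hm : (3 <= m)%N) :
  pseudo_telepathy R (hadamard_graph (4 * m)%N) (4 * m)%N.
Proof.
have -> : (4 * m = 2 * m + 2 * m)%N by lia.
split.
  have [|z prim] := @prim_root_exists R[i]%C (2 * m + 2 * m); first by lia.
  by exists (fourier_protocol prim); apply: fourier_protocol_successful.
case=> p /classical_successful_deterministic [w win].
apply: (@hadamard_not_colourable (2 * m) (fun x => calice p x w)); [lia|lia|].
have w0 : weight (zerof (2 * m + 2 * m)) = 0 by apply/eqP; rewrite weight_eq0.
move=> x y xy; have xNy : x != y.
  by apply: contra_eq_neq xy => ->; rewrite xorff w0; lia.
have /win : allowed (hadamard_graph (2 * m + 2 * m)) x y.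
  rewrite /allowed /hadamard_graph hamming_xorf xy.
  by apply/orP; right; apply/eqP; lia.
(* Equal questions force Bob's colour at [y] to be Alice's, so winning on the edge separates Alice's
   own colours. *)
have /win : allowed (hadamard_graph (2 * m + 2 * m)) y y.
  by rewrite /allowed eqxx.
by rewrite /winning eqxx /= (negbTE xNy) /= orbF => /eqP ->.
Qed.
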